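(* Let $f$, $\varphi$, $\psi=f+\varphi$, $\tau>0$, $\bar x$, $\bar v=-\nabla f(\bar x)$, $\bar z=\bar x+\tau\bar v$ be as in the context. Assume that: (1) $\varphi$ is globally prox-regular at $\bar x$ for $\bar v$ with constant $\rho$, and $\tau\rho<1$; (2) $\varphi$ is twice epi-differentiable at $\bar x$ for $\bar v$ and $\mathrm{d}^2\varphi(\bar x|\bar v)(h)=\langle h,Qh\rangle+\iota_S(h)$ for all $h\in\mathbb{R}^n$, where $S\subseteq\mathbb{R}^n$ is a closed convex cone and $Q\in\mathbb{R}^{n\times n}$ is symmetric with $\mathcal{R}(Q)\subseteq\mathrm{aff}(S)$; (3) for every $D\in\partial\mathrm{prox}_{\tau\varphi}(\bar z)$ there is a symmetric matrix $A$ with $$D=\Pi_{\mathcal{R}(D)}(I+\tau A)^{-1}\Pi_{\mathcal{R}(D)},\quad \mathcal{R}(A)\subseteq\mathcal{R}(D)\subseteq\mathrm{aff}(S),\quad A\succeq\Pi_{\mathcal{R}(D)}Q\Pi_{\mathcal{R}(D)}.$$ If there is $\sigma>0$ such that $$\langle h,[\nabla^2 f(\bar x)+Q]h\rangle\ge\sigma\|h\|^2\quad\forall\,h\in\mathrm{aff}(S),$$ then there is $\sigma>0$ such that $$D\nabla^2 f(\bar x)D+\tau^{-1}D(I-D)\succeq\sigma D^2\quad\forall\,D\in\partial\mathrm{prox}_{\tau\varphi}(\bar z).$$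
   Context: Setting: $f:\mathbb{R}^n\to\mathbb{R}$ is twice continuously differentiable, $\varphi:\mathbb{R}^n\to(-\infty,\infty]$ is proper, lower semicontinuous (lsc) and prox-bounded, $\psi=f+\varphi$, $\tau>0$, and $\bar x$ satisfies $0\in\partial\psi(\bar x)$. Here $\partial$ (for extended real-valued functions) is the limiting subdifferential: $\hat\partial\theta(x)=\{v:\theta(y)\ge\theta(x)+\langle v,y-x\rangle+o(\|y-x\|)\}$ and $\partial\theta(x)=\limsup_{y\to x,\,\theta(y)\to\theta(x)}\hat\partial\theta(y)$. Global prox-regularity: $\varphi$ is globally prox-regular at $\bar x$ for $\bar v\in\partial\varphi(\bar x)$ with constant $\rho$ if $\varphi$ is locally lsc at $\bar x$ and there is $\epsilon>0$ such that $\varphi(x')\ge\varphi(x)+\langle v,x'-x\rangle-\frac{\rho}{2}\|x'-x\|^2$ for all $x'\in\mathbb{R}^n$ whenever $\|x-\bar x\|<\epsilon$, $\|v-\bar v\|<\epsilon$, $v\in\partial\varphi(x)$, $\varphi(x)<\varphi(\bar x)+\epsilon$. Proximity operator: $\mathrm{prox}_{\tau\varphi}(x)\in\mathrm{argmin}_{y}\,\varphi(y)+\frac{1}{2\tau}\|x-y\|^2$; under (1) it is single-valued and Lipschitz continuous near $\bar z$. For a locally Lipschitz map $G$, $\partial_BG(x)$ is the set of limits of Jacobians $\mathcal{D}G(x^k)$ with $x^k\to x$ and $G$ differentiable at $x^k$, and $\partial G(x)=\mathrm{conv}(\partial_BG(x))$ is Clarke's generalized Jacobian. Second subderivative: $\mathrm{d}^2\theta(x|\alpha)(h)=\liminf_{t\downarrow0,\,\tilde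 h\to h}\Delta_t^2\theta(x|\alpha)(\tilde h)$ with $\Delta_t^2\theta(x|\alpha)(h)=\frac{\theta(x+th)-\theta(x)-t\langle\alpha,h\rangle}{\frac12t^2}$; $\theta$ is twice epi-differentiable at $x$ for $\alpha$ if the functions $\Delta_t^2\theta(x|\alpha)$ epi-converge as $t\downarrow0$. Notation: $\iota_S$ is the indicator function, $\mathrm{aff}(S)$ the affine hull, $\mathcal{R}(\cdot)$ the range of a matrix, $\Pi_L$ the orthogonal projection matrix onto a subspace $L$, and $A\succeq B$ means $A-B$ is positive semidefinite. *)

(* Defs.v *)
From HB Require Import structures.
From mathcomp Require Import all_boot all_order all_algebra.
From mathcomp Require Import all_classical all_reals all_analysis.

Set Implicit Arguments.
Unset Strict Implicit.
Unset Printing Implicit Defensive.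

Import Order.TTheory GRing.Theory Num.Theory.
Import numFieldNormedType.Exports.

Local Open Scope classical_set_scope.
Local Open Scope ring_scope.

(* Vectors of R^n are columns.  The library norm on matrices is the max norm,
   which induces the usual topology and notion of differentiability; everything
   metric below goes through the Euclidean norm [enorm]. *)

Section Euclidean.
Context {R : realType} {n : nat}.
Implicit Types (u v x : 'cV[R]_n) (A B M P : 'M[R]_n) (L S : set 'cV[R]_n).

Definition dot u v : R := \sum_i u i 0 * v i 0.

Definition enorm u : R := Num.sqrt (dot u u).

Definition psd M : Prop := M^T = M /\ forall x, 0 <= dot x (M *m x).

Definition loewner_ge A B : Prop := psd (A - B).

Definition mxrange M : set 'cV[R]_n := range (fun x => M *m x).

Definition is_orth_proj L P : Prop :=
  forall x, L (P *m x) /\ forall y, L y -> dot (x - P *m x) y = 0.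

(* The matrix of the orthogonal projection onto the subspace L, which exists and
   is unique; see [orth_proj_mxrange] for ranges of matrices. *)
Definition orth_proj L : 'M[R]_n := xget 0 [set P | is_orth_proj L P].

(* Cones contain the origin. *)
Definition cone S : Prop :=
  S 0 /\ forall (t : R) x, 0 < t -> S x -> S (t *: x).

Definition indicator S x : \bar R := if x \in S then 0%E else +oo%E.

Lemma dotE u v : dot u v = (u^T *m v) 0 0.
Proof. by rewrite mxE; apply: eq_bigr => i _; rewrite mxE. Qed.

Lemma dot_eq0 u : dot u u = 0 -> u = 0.
Proof.
move=> /psumr_eq0P u0; apply/colP => i; rewrite mxE.
have /eqP : u i 0 * u i 0 = 0.
  by apply: u0 => // j _; rewrite -expr2 sqr_ge0.
by rewrite mulf_eq0 orbb => /eqP.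
Qed.

Lemma orth_proj_mxrange M : is_orth_proj (mxrange M) (orth_proj (mxrange M)).
Proof.
pose P := proj_mx << M^T >>%MS (kermx M).
have MK0 : (<< M^T >> :&: kermx M = 0)%MS.
  apply/eqP/rowV0P => u; rewrite sub_capmx genmxE sub_kermx.
  move=> /andP[/submxP[w uE] /eqP uM].
  apply: trmx_inj; rewrite trmx0; apply: dot_eq0.
  by rewrite dotE trmxK {2}uE trmx_mul trmxK mulmxA uM mul0mx mxE.
have MK1 : (1%:M <= << M^T >> + kermx M)%MS.
  have := mxrank_sum_cap << M^T >>%MS (kermx M).
  rewrite MK0 mxrank0 addn0 genmxE mxrank_ker mxrank_tr subnKC ?rank_leq_row //.
  by rewrite sub1mx /row_full => ->.
rewrite /orth_proj; apply: (@xgetPex _ 0 [set A | is_orth_proj (mxrange M) A]).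
exists P^T => x; split.
  have /submxP[w xP] : (x^T *m P <= M^T)%MS.
    by rewrite -(genmxE M^T) proj_mx_sub.
  by exists w^T => //; apply: trmx_inj; rewrite !trmx_mul !trmxK -xP.
move=> _ [z _ <-]; rewrite dotE linearB /= trmx_mul trmxK mulmxA.
have : (x^T - x^T *m P <= kermx M)%MS.
  apply: proj_mx_compl_sub; apply: submx_trans MK1; exact: submx1.
by rewrite sub_kermx => /eqP ->; rewrite mul0mx mxE.
Qed.

End Euclidean.

Section Hulls.
Context {R : realType} {V : lmodType R}.

Definition aff (S : set V) : set V :=
  [set x | exists (k : nat) (p : 'I_k -> V) (w : 'I_k -> R),
     [/\ forall i, S (p i), \sum_i w i = 1 & x = \sum_i w i *: p i]].

Definition convex_hull (S : set V) : set V :=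
  [set x | exists (k : nat) (p : 'I_k -> V) (w : 'I_k -> R),
     [/\ forall i, S (p i), forall i, 0 <= w i, \sum_i w i = 1
       & x = \sum_i w i *: p i]].

End Hulls.

Section Derivatives.
Context {R : realType} {n : nat}.
Implicit Types (f : 'cV[R]_n -> R) (G : 'cV[R]_n -> 'cV[R]_n) (x : 'cV[R]_n).

Definition grad f x : 'cV[R]_n := \col_i 'd f x (delta_mx i 0).

(* The library's ['J G x] is for row vectors, hence transposed. *)
Definition jac G x : 'M[R]_n := \matrix_(i, j) ('d G x (delta_mx j 0)) i 0.

Definition hess f : 'cV[R]_n -> 'M[R]_n := jac (grad f).

Definition C2 f : Prop :=
  [/\ forall x, differentiable f x, forall x, differentiable (grad f) x
    & continuous (hess f)].

Definition bouligand_jac G x : set 'M[R]_n :=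
  [set D | exists u : nat -> 'cV[R]_n,
     [/\ u k @[k --> \oo] --> x, forall k, differentiable G (u k)
       & jac G (u k) @[k --> \oo] --> D]].

Definition clarke_jac G x : set 'M[R]_n := convex_hull (bouligand_jac G x).

End Derivatives.

Section SetConvergence.
Context {I : Type} {T : topologicalType}.
Implicit Types (F : set_system I) (C : I -> set T).

(* Painleve-Kuratowski limits of the sets C t along the filter F. *)
Definition outer_limit F C : set T :=
  [set x | forall V E, nbhs x V -> F E -> exists2 t, E t & C t `&` V !=set0].

Definition inner_limit F C : set T :=
  [set x | forall V, nbhs x V -> F [set t | C t `&` V !=set0]].

End SetConvergence.

Section VariationalAnalysis.
Context {R : realType} {n : nat}.
Implicit Types (theta phi g : 'cV[R]_n -> \bar R) (x v h : 'cV[R]_n).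
Local Open Scope ereal_scope.

Definition proper_function phi : Prop :=
  (forall x, -oo < phi x) /\ exists x, phi x < +oo.

Definition locally_lsc phi x : Prop :=
  phi x \is a fin_num /\
  exists2 e : R, (0 < e)%R & forall a : R, a%:E <= phi x + e%:E ->
    closed [set y | (enorm (y - x) <= e)%R /\ phi y <= a%:E].

Definition moreau_fun (tau : R) phi x y : \bar R :=
  phi y + ((2 * tau)^-1 * enorm (x - y) ^+ 2)%:E.

Definition prox_bounded phi : Prop :=
  exists (lam : R) x, (0 < lam)%R /\ -oo < ereal_inf (range (moreau_fun lam phi x)).

(* A selection of the set-valued map argmin_y (phi y + |x - y|^2 / (2 tau)); the
   value is 0 where this set is empty. *)
Definition prox (tau : R) phi x : 'cV[R]_n :=
  xget 0%R [set y | forall y', moreau_fun tau phi x y <= moreau_fun tau phi x y'].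

Definition regular_subdiff theta x : set 'cV[R]_n :=
  [set v | theta x \is a fin_num /\
     forall e : R, (0 < e)%R -> \forall y \near x,
       theta x + (dot v (y - x) - e * enorm (y - x))%:E <= theta y].

Definition subdiff theta x : set 'cV[R]_n :=
  [set v | theta x \is a fin_num /\
     exists (y w : nat -> 'cV[R]_n),
     [/\ forall k, regular_subdiff theta (y k) (w k),
         y k @[k --> \oo] --> x, theta (y k) @[k --> \oo] --> theta x
       & w k @[k --> \oo] --> v]].

Definition globally_prox_regular phi xbar vbar (rho : R) : Prop :=
  [/\ subdiff phi xbar vbar, locally_lsc phi xbar &
    exists2 e : R, (0 < e)%R & forall x v,
      (enorm (x - xbar) < e)%R -> (enorm (v - vbar) < e)%R ->
      subdiff phi x v -> phi x < phi xbar + e%:E ->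
      forall x', phi x + (dot v (x' - x) - rho / 2 * enorm (x' - x) ^+ 2)%:E
                 <= phi x'].

Definition second_quotient theta x a (t : R) h : \bar R :=
  (theta (x + t *: h)%R - theta x - (t * dot a h)%:E) * ((2^-1 * t ^+ 2)^-1)%:E.

Definition second_subderivative theta x a h : \bar R :=
  limf_einf (fun p : R * 'cV[R]_n => second_quotient theta x a p.1 p.2)
            (filter_prod (0%R^'+) (nbhs h)).

Definition epigraph g : set ('cV[R]_n * R) := [set p | g p.1 <= p.2%:E].

Definition epi_converges {I : Type} (F : set_system I)
    (gs : I -> 'cV[R]_n -> \bar R) g : Prop :=
  outer_limit F (fun t => epigraph (gs t)) = epigraph g /\
  inner_limit F (fun t => epigraph (gs t)) = epigraph g.

Definition twice_epi_differentiable theta x a : Prop :=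
  exists g, epi_converges (0%R^'+) (second_quotient theta x a) g.

End VariationalAnalysis.

(* Main.v *)
Require Import Defs.
From HB Require Import structures.
From mathcomp Require Import all_boot all_order all_algebra.
From mathcomp Require Import all_classical all_reals all_analysis.
From mathcomp Require Import ring lra.

(** Let D be an element of the generalized Jacobian, P the orthogonal projection
    onto its range, H the Hessian of f at xbar, and A the symmetric matrix in the
    representation D = P (I + tau A)^-1 P.  As the range of A lies in that of P,
    A and P commute, so that the representation can be inverted:
    D + tau A D = P.  Multiplying by D on the left and using D P = D turns the
    nonlinear term into a congruence ([resolvent_defect]):
<<
        D (I - D) = D (P - D) = tau D A D.
>>
    Hence D H D + tau^-1 D (I - D) = D (H + A) D.  On the vector y = D x, which
    belongs to the range of D and therefore to aff S and to the fixed points of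
    P, the bound on A gives <y, A y> >= <y, P Q P y> = <y, Q y>, and the
    assumed coercivity of H + Q on aff S gives the lower bound
    sigma |y|^2 = sigma <x, D^2 x>, with the same sigma.

    The Loewner order also demands that the matrices be symmetric, hence that H
    be: this is the theorem on the equality of mixed second derivatives
    ([mixed_diffC]).  By the mean value theorem the second difference
<<
        f (x + t u + t v) - f (x + t u) - f (x + t v) + f x
>>
    is t^2 times the second differential at (u, v), up to o(t^2)
    ([second_difference_approx]); it is symmetric in u and v by inspection. *)

Set Implicit Arguments.
Unset Strict Implicit.
Unset Printing Implicit Defensive.

Import Order.TTheory GRing.Theory Num.Theory.
Import numFieldNormedType.Exports.

Local Open Scope classical_set_scope.
Local Open Scope ring_scope.

(** * Symmetry of second derivatives *)

Section MixedDerivatives.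
Context {R : realType} {V : normedModType R}.
Implicit Types (f g : V -> R) (x u v : V) (t : R).

Definition second_difference f x u v t : R :=
  f (x + t *: u + t *: v) - f (x + t *: u) - f (x + t *: v) + f x.

Lemma second_differenceC f x u v t :
  second_difference f x u v t = second_difference f x v u t.
Proof.
rewrite /second_difference -!addrA [t *: u + _]addrC.
by congr (_ + _); rewrite addrCA.
Qed.

Lemma differential_approx g x : differentiable g x ->
  forall e, 0 < e -> exists2 d : R, 0 < d &
    forall h, `|h| < d -> `|g (x + h) - g x - 'd g x h| <= e * `|h|.
Proof.
move=> gx e e0.
have /nbhs_normP[d /= d0 dP] : \forall h \near (0 : V),
    `|g (x + h) - g x - 'd g x h| <= e * `|h|.
  have /eqaddoP/(_ e e0) := diff_locally gx.
  apply: filterS => h; rewrite [_ h](_ : _ = g (x + h) - g x - 'd g x h) //.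
  transitivity (g (h + x) - (g x + 'd g x h)) => //.
  by rewrite opprD addrA [h + x]addrC.
by exists d => // h hd; apply: dP; rewrite /= sub0r normrN.
Qed.

Lemma is_derive_line f a u s : differentiable f (a + s *: u) ->
  is_derive s 1 (fun r : R => f (a + r *: u)) ('d f (a + s *: u) u).
Proof.
move=> df.
have eqq : (fun h : R => h^-1 *: (f (a + (h *: 1 + s) *: u) - f (a + s *: u)))
   = (fun h : R => h^-1 *: (f (h *: u + (a + s *: u)) - f (a + s *: u))).
  apply/funext => h; congr (_ *: (f _ - _)).
  by rewrite scalerDl addrCA; congr (_ *: _ + _); rewrite /GRing.scale /= mulr1.
apply: DeriveDef.
  by rewrite /derivable /= eqq; exact: diff_derivable.
by rewrite -deriveE // /derive /= eqq.
Qed.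

(** The second difference is the increment over [0, t] of the function
    s |-> f (x + t v + s u) - f (x + s u), to which the mean value theorem
    applies. *)
Lemma second_difference_mean f x u v t : (forall y, differentiable f y) ->
  0 < t -> exists2 s, 0 < s < t &
    second_difference f x u v t
    = t * ('d f (x + s *: u + t *: v) u - 'd f (x + s *: u) u).
Proof.
move=> df t0; pose k (s : R) := f (x + t *: v + s *: u) - f (x + s *: u).
have dk (s : R) :
    is_derive s 1 k ('d f (x + t *: v + s *: u) u - 'd f (x + s *: u) u).
  by apply: is_deriveB; exact: is_derive_line.
have ck : {within `[0, t], continuous k}.
  apply: derivable_within_continuous => s _.
  by case: (dk s).
have [s s0t] := MVT t0 (fun s _ => dk s) ck.
rewrite /k subr0 !scale0r !addr0 [x + t *: v + _]addrAC [x + t *: v + _]addrAC.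
move=> keq; exists s; first by move: s0t; rewrite in_itv.
by rewrite mulrC -keq /second_difference; ring.
Qed.

(** The increment of the first derivative between the two parallel segments of
    the mean value theorem is, up to o(t), its differential at t v: differences
    of two points near x are controlled by differentiability at x alone. *)
Lemma second_difference_approx f x u v :
    (forall y, differentiable f y) ->
    differentiable (fun y => 'd f y u) x ->
  forall e, 0 < e -> exists2 d : R, 0 < d & forall t, 0 < t < d ->
    `|second_difference f x u v t - t ^+ 2 * 'd (fun y => 'd f y u) x v|
      <= e * t ^+ 2.
Proof.
move=> df dfu e e0; pose g y : R := 'd f y u.
(* For 0 < s < t, both displacements s u + t v and s u have norm at most t c,
   and two errors of e / (2 c) * t c add up to e t. *)
pose c := `|u| + `|v| + 1.
have c0 : 0 < c by rewrite ltr_wpDl // addr_ge0.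
have e'0 : 0 < e / (2 * c) by rewrite divr_gt0 // mulr_gt0.
have [d d0 gd] := @differential_approx g x dfu _ e'0.
exists (d / c); first exact: divr_gt0.
move=> t /andP[t0 td].
have [s /andP[s0 st] ->] := second_difference_mean x u v df t0.
rewrite -/(g (x + s *: u + t *: v)) -/(g (x + s *: u)) -/g.
have tcd : t * c < d by rewrite -ltr_pdivlMr.
have suc : `|s *: u| <= t * `|u| by rewrite normrZ gtr0_norm // ler_wpM2r // ltW.
have w1c : `|s *: u + t *: v| <= t * c.
  apply: (le_trans (ler_normD _ _)); rewrite [`|t *: v|]normrZ (gtr0_norm t0) /c.
  by move: suc; rewrite !mulrDr; lra.
have w2c : `|s *: u| <= t * c.
  apply: (le_trans suc); rewrite ler_pM2l // /c.
  by have := normr_ge0 v; lra.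
have g1 := gd _ (le_lt_trans w1c tcd).
have g2 := gd _ (le_lt_trans w2c tcd).
rewrite addrA linearD [X in _ - (_ + X)]linearZ in g1.
set a := g (x + _ + _) in g1 *; set b := g (x + _) in g2 *.
set p := 'd g x (s *: u) in g1 g2; set q := 'd g x v in g1 *.
have -> : t * (a - b) - t ^+ 2 * q
    = t * ((a - g x - (p + t *: q)) - (b - g x - p)).
  by rewrite /GRing.scale /=; ring.
rewrite normrM gtr0_norm // expr2 mulrCA ler_pM2l //.
apply: (le_trans (ler_normB _ _)).
apply: (le_trans (lerD g1 g2)); rewrite -mulrDr.
have -> : e * t = e / (2 * c) * (t * c + t * c) by field; lra.
by rewrite ler_pM2l // lerD.
Qed.

(** Both sides approximate the same second difference to within e / 2 * t^2 for
    small t, so they differ by at most e. *)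
Lemma mixed_diffC f x u v :
    (forall y, differentiable f y) ->
    differentiable (fun y => 'd f y u) x ->
    differentiable (fun y => 'd f y v) x ->
  'd (fun y => 'd f y u) x v = 'd (fun y => 'd f y v) x u.
Proof.
move=> df du dv; set p := 'd _ x v; set q := 'd _ x u.
apply/eqP; rewrite -subr_eq0 -normr_le0; apply/ler_addgt0Pr => e e0.
rewrite add0r.
have e20 : 0 < e / 2 by lra.
have [d1 d10 d1P] := second_difference_approx v df du e20.
have [d2 d20 d2P] := second_difference_approx u df dv e20.
pose t := Num.min d1 d2 / 2.
have m0 : 0 < Num.min d1 d2 by rewrite lt_min d10.
have t0 : 0 < t by rewrite divr_gt0.
have tm : t < Num.min d1 d2 by rewrite /t; lra.
have /andP[td1 td2] : (t < d1) && (t < d2) by rewrite -lt_min.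
have /d1P : 0 < t < d1 by rewrite t0.
have /d2P : 0 < t < d2 by rewrite t0.
rewrite (second_differenceC f x v u) -/p -/q.
set w := second_difference _ _ _ _ _ => wq wp.
have t20 : 0 < t ^+ 2 by rewrite exprn_gt0.
rewrite -(ler_pM2r t20) -[in leLHS](gtr0_norm t20) -normrM.
have -> : (p - q) * t ^+ 2 = (w - t ^+ 2 * q) - (w - t ^+ 2 * p) by ring.
apply: (le_trans (ler_normB _ _)); apply: (le_trans (lerD wq wp)).
by rewrite -mulrDl -splitr.
Qed.

End MixedDerivatives.

Section Hessian.
Context {R : realType} {n : nat}.
Implicit Types (f : 'cV[R]_n -> R) (G : 'cV[R]_n -> 'cV[R]_n) (x : 'cV[R]_n).

Lemma differentiable_entry G x i :
  differentiable G x -> differentiable (fun y => G y i 0) x.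
Proof.
move=> dG; rewrite (_ : (fun y => _) = (fun c : 'cV[R]_n => c i 0) \o G) //.
by apply: differentiable_comp => //; exact: differentiable_coord.
Qed.

Lemma jacE G x i j : differentiable G x ->
  jac G x i j = 'd (fun y => G y i 0) x (delta_mx j 0).
Proof.
move=> dG; rewrite mxE -!deriveE //; last exact: differentiable_entry.
by rewrite derive_mx ?mxE //; exact: diff_derivable.
Qed.

Lemma hess_sym f x :
    (forall y, differentiable f y) -> differentiable (grad f) x ->
  (hess f x)^T = hess f x.
Proof.
move=> df dg.
have gradE i : (fun y => grad f y i 0) = (fun y => 'd f y (delta_mx i 0)).
  by apply/funext => y; rewrite mxE.
have dgi i : differentiable (fun y => 'd f y (delta_mx i 0)) x.
  by rewrite -gradE; exact: differentiable_entry.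
apply/matrixP => i j; rewrite [LHS]mxE /hess !jacE // !gradE.
exact: mixed_diffC.
Qed.

End Hessian.

(** * Orthogonal projections and resolvents *)

Section LinearAlgebra.
Context {R : realType} {n : nat}.
Implicit Types (x y : 'cV[R]_n) (A D M P Q : 'M[R]_n).

Lemma enorm_sqr x : enorm x ^+ 2 = dot x x.
Proof.
rewrite /enorm sqr_sqrtr //; apply: sumr_ge0 => i _.
by rewrite -expr2 sqr_ge0.
Qed.

Lemma dotC x y : dot x y = dot y x.
Proof. by apply: eq_bigr => i _; rewrite mulrC. Qed.

Lemma dot_mulmxl M x y : dot (M *m x) y = dot x (M^T *m y).
Proof. by rewrite !dotE trmx_mul mulmxA. Qed.

Lemma dotBl x y z : dot (x - y) z = dot x z - dot y z.
Proof. by rewrite !dotE linearB mulmxBl !mxE. Qed.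

Lemma dotBr x y z : dot x (y - z) = dot x y - dot x z.
Proof. by rewrite !dotE mulmxBr !mxE. Qed.

Lemma dotDr x y z : dot x (y + z) = dot x y + dot x z.
Proof. by rewrite !dotE mulmxDr !mxE. Qed.

Lemma dotZr a x y : dot x (a *: y) = a * dot x y.
Proof. by rewrite !dotE -scalemxAr !mxE. Qed.

Lemma mulmx_col_inj M P : (forall x, M *m x = P *m x) -> M = P.
Proof.
move=> MP; apply/matrixP => i j.
by have /colP/(_ i) := MP (delta_mx j 0); rewrite -!colE !mxE.
Qed.

Lemma orth_proj_id M x : mxrange M x -> orth_proj (mxrange M) *m x = x.
Proof.
set P := orth_proj _ => Mx; have [[z _ zP] Pperp] := orth_proj_mxrange M x.
apply/esym/subr0_eq/dot_eq0; apply: Pperp; case: Mx => w _ wx.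
by exists (w - z) => //; rewrite mulmxBr wx zP.
Qed.

Lemma orth_proj_mul M A : mxrange A `<=` mxrange M ->
  orth_proj (mxrange M) *m A = A.
Proof.
move=> AM; apply: mulmx_col_inj => x; rewrite -mulmxA.
by apply/orth_proj_id/AM; exists x.
Qed.

(** Since P y is orthogonal to z - P z, one has <P y, z> = <P y, P z> for all
    y and z, which says P^T P = P; the left-hand side is symmetric. *)
Lemma orth_proj_sym M : (orth_proj (mxrange M))^T = orth_proj (mxrange M).
Proof.
set P := orth_proj _.
have PP : P^T *m P = P.
  apply: mulmx_col_inj => y; apply/esym/subr0_eq/dot_eq0.
  set z := _ - _.
  have [Py _] := orth_proj_mxrange M y.
  have [Pz /(_ _ Py)] := orth_proj_mxrange M z; rewrite -/P.
  rewrite dotBl -/P !(dotC _ (P *m y)) => /subr0_eq perp.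
  by rewrite {1}/z dotBl -mulmxA (dot_mulmxl P^T) trmxK perp subrr.
by rewrite -{1}PP trmx_mul trmxK.
Qed.

(** The range condition and symmetry give P A = A = A P, so that P commutes with
    I + tau A and (I + tau A) D = P P.  Applying D, which absorbs P on either
    side, to P P - D = tau A D gives the formula. *)
Lemma resolvent_defect (tau : R) D A (P := orth_proj (mxrange D)) :
    A^T = A -> 1%:M + tau *: A \in unitmx ->
    D = P *m invmx (1%:M + tau *: A) *m P ->
    mxrange A `<=` mxrange D ->
  D^T = D /\ D *m (1%:M - D) = tau *: (D *m A *m D).
Proof.
move=> Asym Eu DE AD; set E := 1%:M + tau *: A in Eu DE.
have Psym : P^T = P := orth_proj_sym D.
have PA : P *m A = A by exact: orth_proj_mul.
have AP : A *m P = A by rewrite -[in LHS]Asym -Psym -trmx_mul PA Asym.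
have PD : P *m D = D by apply: orth_proj_mul.
have PE : P *m E = E *m P.
  by rewrite /E mulmxDr mulmxDl mulmx1 mul1mx -scalemxAr -scalemxAl PA AP.
have Esym : E^T = E by rewrite /E linearD linearZ /= trmx1 Asym.
have Dsym : D^T = D.
  by rewrite DE !trmx_mul Psym trmx_inv Esym mulmxA.
split=> //.
have DP : D *m P = D by rewrite -[in LHS]Dsym -Psym -trmx_mul PD Dsym.
have ED : E *m D = P *m P.
  by rewrite DE 2!mulmxA -PE -[P *m E *m _]mulmxA mulmxV // mulmx1.
have PDE : P *m P - D = tau *: (A *m D).
  by rewrite -ED /E mulmxDl mul1mx -scalemxAl addrC addKr.
by rewrite -mulmxA scalemxAr -PDE !mulmxBr mulmx1 mulmxA !DP.
Qed.

End LinearAlgebra.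

(** * Positive definiteness on the generalized Jacobian *)

Theorem proposition2p3 (R : realType) (n : nat)
    (f : 'cV[R]_n -> R) (phi : 'cV[R]_n -> \bar R) (tau rho : R)
    (xbar vbar zbar : 'cV[R]_n) (S : set 'cV[R]_n) (Q : 'M[R]_n)
    (hf : C2 f)
    (phi_proper : proper_function phi)
    (phi_lsc : lower_semicontinuous phi)
    (phi_prox_bounded : prox_bounded phi)
    (tau_gt0 : 0 < tau)
    (xbar_crit : subdiff (fun x => ((f x)%:E + phi x)%E) xbar 0)
    (def_vbar : vbar = - grad f xbar)
    (def_zbar : zbar = xbar + tau *: vbar)
    (prox_reg : globally_prox_regular phi xbar vbar rho)
    (tau_rho : tau * rho < 1)
    (twice_epi : twice_epi_differentiable phi xbar vbar)
    (S_closed : closed S)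
    (S_convex : convex_set S)
    (S_cone : cone S)
    (Q_sym : Q^T = Q)
    (Q_range : mxrange Q `<=` aff S)
    (second_subder : forall h, second_subderivative phi xbar vbar h
                               = ((dot h (Q *m h))%:E + indicator S h)%E)
    (clarke_prox : forall D, clarke_jac (prox tau phi) zbar D ->
       exists A : 'M[R]_n,
         let P := orth_proj (mxrange D) in
         [/\ A^T = A,
             1%:M + tau *: A \in unitmx /\
               D = P *m invmx (1%:M + tau *: A) *m P,
             mxrange A `<=` mxrange D,
             mxrange D `<=` aff S
           & loewner_ge A (P *m Q *m P)]) :
  (exists2 sigma : R, 0 < sigma &
     forall h, aff S h ->
       sigma * enorm h ^+ 2 <= dot h ((hess f xbar + Q) *m h)) ->
  exists2 sigma : R, 0 < sigma &
    forall D, clarke_jac (prox tau phi) zbar D ->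
      loewner_ge (D *m hess f xbar *m D + tau^-1 *: (D *m (1%:M - D)))
                 (sigma *: (D *m D)).
Proof.
move=> [sigma sigma0 coercive]; exists sigma => // D /clarke_prox[A].
set P := orth_proj _ => -[Asym [Eu DE] AD DS [_ AQ]].
have [Dsym defect] := resolvent_defect Asym Eu DE AD.
have Hsym : (hess f xbar)^T = hess f xbar by case: hf => df dg _; exact: hess_sym.
rewrite defect scalerA mulVf ?gt_eqF // scale1r; split.
  by rewrite linearB linearD linearZ /= !trmx_mul Dsym Asym Hsym !mulmxA.
move=> x; set y := D *m x.
have Dy : mxrange D y by exists x.
have Py : P *m y = y by exact: orth_proj_id.
have -> : dot x ((D *m hess f xbar *m D + D *m A *m D - sigma *: (D *m D)) *m x)
    = dot y (hess f xbar *m y) + dot y (A *m y) - sigma * dot y y.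
  rewrite mulmxBl mulmxDl dotBr dotDr -scalemxAl dotZr /y.
  by rewrite !dot_mulmxl Dsym !mulmxA.
have AQy : dot y (Q *m y) <= dot y (A *m y).
  move: (AQ y); rewrite mulmxBl dotBr subr_ge0; apply: le_trans.
  by rewrite -!mulmxA Py -[P in P *m (Q *m y)]orth_proj_sym -dot_mulmxl Py.
have := coercive y (DS _ Dy); rewrite enorm_sqr mulmxDl dotDr.
lra.
Qed.
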